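(* Let $\mathbb{k}$ be an arbitrary field, $R=\mathbb{k}[x_1,\ldots,x_d]$ a polynomial ring with the standard grading, and let $\underline{\nu}=\nu_1,\ldots,\nu_r$ be normalized monomial valuations on $R$. For each integer $n\geq 0$ let $$I_n(\underline{\nu})=\{f\in R \mid \nu_i(f)\geq n \text{ for all } 1\leq i\leq r\}.$$ Then: (1) $a_i(I_n(\underline{\nu}))\geq m\, a_i\big(I_{\lceil n/m\rceil}(\underline{\nu})\big)$ for all integers $n,m>0$ and all $0\leq i\leq \dim(R/I_1(\underline{\nu}))$. (2) The limit $\lim_{n\to\infty}\dfrac{\operatorname{reg}(I_n(\underline{\nu}))}{n}$ exists. In particular, (1) and (2) hold for the filtration $\{I^{(n)}\}_{n\geq 0}$ of symbolic powers of a squarefree monomial ideal $I\subseteq R$, and for the filtration $\{\overline{J^{n/e}}\}_{n\geq 0}$ of rational powers of a monomial ideal $J\subseteq R$, where $e$ is the least common multiple of the values on $J$ of the Rees valuations of $J$.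
   Context: A monomial valuation on $R$ is a valuation $\nu:R\setminus\{0\}\to\mathbb{R}_{\geq 0}$ (so $\nu(fg)=\nu(f)+\nu(g)$ and $\nu(f+g)\geq\min\{\nu(f),\nu(g)\}$) such that $\nu(\sum_\alpha\lambda_\alpha x^\alpha)=\min\{\nu(x^\alpha)\mid\lambda_\alpha\neq 0\}$; it is determined by a vector $w$ with $\nu(x^\alpha)=w\cdot\alpha$. It is normalized if $w\in\mathbb{Z}_{\geq 0}^d$. Convention: $\nu(0)=\infty$. The ideals $I_n(\underline{\nu})$ are monomial. Let $\mathfrak{m}=(x_1,\ldots,x_d)$. For a finitely generated graded $R$-module $M$, $a_i(M)=\max\{n\in\mathbb{Z}\mid [H^i_{\mathfrak{m}}(M)]_n\neq 0\}$ if $H^i_{\mathfrak m}(M)\neq 0$, and $a_i(M)=-\infty$ otherwise; $\operatorname{reg}(M)=\max\{a_i(M)+i\mid i\geq 0\}$ is the Castelnuovo–Mumford regularity. For a radical ideal $I$, the $n$-th symbolic power is $I^{(n)}=\bigcap_{\mathfrak p}(I^nR_{\mathfrak p}\cap R)$, over the minimal primes $\mathfrak p$ of $I$. If $I=Q_1\cap\cdots\cap Q_r$ is the prime decomposition of a squarefree monomial ideal, then $I^{(n)}=I_n(\underline\nu)$ for $\nu_i(f)=\max\{n\mid f\in Q_i^n\}$. For a nonzero proper ideal $J$ and a rational number $p/q\geq 0$ ($p\ge 0$, $q>0$ integers), the rational power is $\overline{J^{p/q}}=\{f\in R\mid f^q\in\overline{J^p}\}$, where the overline on the right denotes integral closure.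 If $J$ is monomial with Rees valuations $v_1,\ldots,v_r$ (which are monomial, taken integer valued), $v_i(J)=\min\{v_i(f)\mid f\in J\}$ and $e=\operatorname{lcm}(v_1(J),\ldots,v_r(J))$, then $\overline{J^{n/e}}=I_n(\underline\nu)$ for $\nu_i=\frac{e}{v_i(J)}v_i$. *)

(* Defs.v *)
From HB Require Import structures.
From mathcomp Require Import all_boot all_order all_algebra.
From mathcomp Require Import mpoly.
From mathcomp Require Import boolp classical_sets reals ereal.
From mathcomp Require Import topology normedtype sequences.

Set Implicit Arguments.
Unset Strict Implicit.
Unset Printing Implicit Defensive.

Import Order.TTheory GRing.Theory Num.Theory.
Import numFieldNormedType.Exports.

Local Open Scope classical_set_scope.
Local Open Scope ring_scope.

(* [ %/ ] is the floor of the quotient. *)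
Definition ceil_div (n m : nat) : nat := (n %/ m + ~~ (m %| n))%N.

Section Ideals.
Context {K : fieldType} {d : nat}.
Notation A := {mpoly K[d]}.

Definition is_ideal (I : set A) : Prop :=
  [/\ I 0, forall f g, I f -> I g -> I (f + g)
    & forall f g, I g -> I (f * g)].

Definition ideal_gen (G : set A) : set A := smallest is_ideal G.

Definition ideal_mul (I J : set A) : set A :=
  ideal_gen [set h | exists f g, [/\ I f, J g & h = f * g]].

Definition ideal_pow (I : set A) (n : nat) : set A :=
  iter n (ideal_mul I) setT.

Definition is_prime_ideal (P : set A) : Prop :=
  [/\ is_ideal P, P != setT & forall f g, P (f * g) -> P f \/ P g].

Definition is_minimal_prime (I P : set A) : Prop :=
  [/\ is_prime_ideal P, I `<=` P
    & forall Q, is_prime_ideal Q -> I `<=` Q -> Q `<=` P -> Q = P].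

(* There is a chain P_0 < ... < P_n of primes containing I, i.e. a chain of
   primes of length n in the quotient by I. *)
Definition has_prime_chain (I : set A) (n : nat) : Prop :=
  exists P : nat -> set A,
    [/\ forall j, (j <= n)%N -> is_prime_ideal (P j),
        I `<=` P 0%N
      & forall j, (j < n)%N -> P j `<` P j.+1].

(* Krull dimension of the quotient ring by I; it is -oo for the zero ring. *)
Definition dim_quotient (R : realType) (I : set A) : \bar R :=
  ereal_sup [set n%:R%:E | n in has_prime_chain I].

Definition is_monomial_ideal (I : set A) : Prop :=
  exists G : set 'X_{1..d}, I = ideal_gen [set 'X_[m] | m in G].

Definition is_squarefree_monomial_ideal (I : set A) : Prop :=
  exists G : set 'X_{1..d},
    (forall m, G m -> forall j : 'I_d, (m j <= 1)%N) /\
    I = ideal_gen [set 'X_[m] | m in G].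

(* The contraction of the localization of I^n at P consists of the f such that
   s * f lies in I^n for some s outside P. *)
Definition symbolic_power (I : set A) (n : nat) : set A :=
  [set f | forall P, is_minimal_prime I P ->
             exists s, ~ P s /\ ideal_pow I n (s * f)].

(* f is a root of X^n + a_1 X^(n-1) + ... + a_n with a_j in I^j. *)
Definition integral_closure (I : set A) : set A :=
  [set f | exists (n : nat) (a : nat -> A),
     [/\ (0 < n)%N,
         forall j, (1 <= j <= n)%N -> ideal_pow I j (a j)
       & f ^+ n + \sum_(1 <= j < n.+1) a j * f ^+ (n - j) = 0]].

(* The exponent is p / q; only meant for q > 0. *)
Definition rational_power (J : set A) (p q : nat) : set A :=
  [set f | integral_closure (ideal_pow J p) (f ^+ q)].

End Ideals.

Section Valuations.
Context {R : realType} {K : fieldType} {d : nat}.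
Notation A := {mpoly K[d]}.

Definition is_valuation (v : A -> \bar R) : Prop :=
  [/\ v 0 = +oo%E,
      forall f, f != 0 -> v f \is a fin_num /\ (0 <= v f)%E,
      forall f g, v (f * g) = (v f + v g)%E
    & forall f g, (Order.min (v f) (v g) <= v (f + g)%R)%E].

Definition is_monomial_valuation (v : A -> \bar R) : Prop :=
  is_valuation v /\
  forall f, v f = ereal_inf [set v 'X_[m] | m in [set m | m \in msupp f]].

Definition is_normalized (v : A -> \bar R) : Prop :=
  forall j : 'I_d, exists w : nat, v 'X_j = w%:R%:E.

Definition valuation_ideal (r : nat) (nu : 'I_r -> A -> \bar R) (n : nat) :
    set A :=
  [set f | forall i, (n%:R%:E <= nu i f)%E].

Definition is_integer_valued (v : A -> \bar R) : Prop :=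
  forall f, f != 0 -> exists n : nat, v f = n%:R%:E.

Definition val_of_ideal (v : A -> \bar R) (J : set A) : \bar R :=
  ereal_inf (v @` J).

(* The valuations selected by S compute the integral closures of all the
   powers of J. *)
Definition computes_closures (J : set A) (r : nat) (v : 'I_r -> A -> \bar R)
    (S : {set 'I_r}) : Prop :=
  forall n f, integral_closure (ideal_pow J n) f <->
    (forall i, i \in S -> (val_of_ideal (v i) (ideal_pow J n) <= v i f)%E).

(* Integer-valued valuations on the polynomial ring, nonnegative there, are the
   discrete valuations of its fraction field whose ring contains it; their
   scaling is left free.  Nontriviality is a consequence of minimality. *)
Definition are_Rees_valuations (J : set A) (r : nat)
    (v : 'I_r -> A -> \bar R) : Prop :=
  [/\ forall i, is_valuation (v i) /\ is_integer_valued (v i),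
      computes_closures J v [set: 'I_r]%SET
    & forall S : {set 'I_r}, S \proper [set: 'I_r]%SET ->
        ~ computes_closures J v S].

End Valuations.

(* Local cohomology of a homogeneous ideal I, as a graded module, with respect
   to (x_1, ..., x_d): the cohomology of the Cech complex on x_1, ..., x_d.
   Its term in cohomological degree p is the direct sum, over the sets S of p
   variables, of the localizations of I at the product x_S of the variables in
   S, which are submodules of the fraction field. *)
Section LocalCohomology.
Context {K : fieldType} {d : nat}.
Notation A := {mpoly K[d]}.
Notation cochain := ({set 'I_d} -> {fraction A}).

Definition var_prod (S : {set 'I_d}) : A := \prod_(j in S) 'X_j.

(* Degree n component of the localization of I at x_S: the fractions
   f / x_S^N with f in I homogeneous of degree n + N * #|S|, or f = 0. *)
Definition localization_deg (I : set A) (S : {set 'I_d}) (n : int) :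
    set {fraction A} :=
  [set z | exists (N : nat) (f : A),
     [/\ I f,
         forall m, m \in msupp f -> (mdeg m)%:Z = n + (N * #|S|)%N%:Z
       & z = tofrac f / tofrac (var_prod S ^+ N)]].

(* p is an integer so that p = -1 gives the zero module. *)
Definition cech_cochain (I : set A) (p n : int) (c : cochain) : Prop :=
  forall S : {set 'I_d},
    if #|S|%:Z == p then localization_deg I S n (c S) else c S = 0.

Definition cech_diff (c : cochain) : cochain := fun T =>
  \sum_(t in T) (-1) ^+ #|[set s in T | (s < t)%N]%SET| * c (T :\ t)%SET.

(* The degree n component of the i-th local cohomology of I is nonzero. *)
Definition local_cohomology_neq0 (I : set A) (i : nat) (n : int) : Prop :=
  exists c : cochain,
    [/\ cech_cochain I i%:Z n c,
        forall T, cech_diff c T = 0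
      & ~ exists b, cech_cochain I (i%:Z - 1) n b /\
                    forall T, c T = cech_diff b T].

(* The supremum is a maximum, or -oo if the local cohomology vanishes, since
   the local cohomology of a finitely generated module is Artinian. *)
Definition a_invariant (R : realType) (I : set A) (i : nat) : \bar R :=
  ereal_sup [set n%:~R%:E | n in local_cohomology_neq0 I i].

Definition regularity (R : realType) (I : set A) : \bar R :=
  ereal_sup [set (a_invariant R I i + i%:R%:E)%E | i in [set: nat]].

End LocalCohomology.

Section Filtrations.
Context {K : fieldType} {d : nat}.
Notation A := {mpoly K[d]}.

Definition a_invariant_growth (R : realType) (F : nat -> set A) : Prop :=
  forall n m i : nat, (0 < n)%N -> (0 < m)%N ->
    (i%:R%:E <= dim_quotient R (F 1%N))%E ->
    (m%:R%:E * a_invariant R (F (ceil_div n m)) i <= a_invariant R (F n) i)%E.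

(* The limit is a real number, except in the degenerate case of a filtration
   by zero ideals, whose regularity is -oo. *)
Definition regularity_limit_exists (R : realType) (F : nat -> set A) : Prop :=
  exists l : \bar R,
    ((fun n : nat => (regularity R (F n) * (n%:R^-1)%:E)%E) @ \oo --> l) /\
    (l \is a fin_num \/ (F 1%N = [set 0] /\ l = -oo%E)).

End Filtrations.

(* Main.v *)
(* In each case F n = {f | w_i . m >= n for all i and all monomials x^m of f} for
   finitely many weight vectors w_i: indicators of the minimal vertex covers for
   symbolic powers, and the vectors (e / v_i(J)) (v_i(x_1), ..., v_i(x_d)) for
   rational powers.  (The v_i need not be known to be monomial: the monomial
   valuation with the same values on the variables is at most v_i, agrees with it
   on J, and is n v_i(J) or more on the integral closure of J^n.)

   The Cech complex of F n is graded by Z^d; its component at al is the complex of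
   cochains on the sets S such that al_j >= 0 off S and, for each i, either
   w_i . al >= n or w_i is nonzero somewhere on S.  Replacing (n, al) by
   (m n, m al) does not change these conditions, which gives (1).

   Call al good for n if its component has cohomology.  If some al_j >= n, the sets
   S form a cone with apex j, so al is not good; and (-1, ..., -1) is good unless
   some w_i is 0, when F n = 0.  If al is good for m, then n al / m rounded up is
   good for n, for n large.  Hence reg (F n) / n tends to the supremum of |al| / n
   over all n > 0 and all al good for n, a real number. *)
Require Import Defs.
From HB Require Import structures.
From mathcomp Require Import all_boot all_order all_algebra.
From mathcomp Require Import mpoly.
From mathcomp Require Import boolp classical_sets reals ereal.
From mathcomp Require Import topology normedtype sequences.
From mathcomp Require Import zify ring lra.

Set Implicit Arguments.
Unset Strict Implicit.
Unset Printing Implicit Defensive.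

Import Order.TTheory GRing.Theory Num.Theory.
Import numFieldNormedType.Exports.

Local Open Scope ring_scope.

(** * Cochains indexed by subsets of the variables *)

Section SetCochains.
Context {d : nat}.
Implicit Types (S T : {set 'I_d}).

(** The formula of [cech_diff] over any ring, for cochains with values in [K], in polynomials or in
    the fraction field alike. *)
Definition coboundary (R : nzRingType) (c : {set 'I_d} -> R) :
    {set 'I_d} -> R := fun T =>
  \sum_(t in T) (-1) ^+ #|[set s in T | (s < t)%N]%SET| * c (T :\ t)%SET.

Definition cochain_on (R : nzRingType) (U : {set 'I_d} -> Prop) (p : nat)
    (c : {set 'I_d} -> R) : Prop :=
  forall S, c S != 0 -> #|S| = p /\ U S.

(* The condition on degrees is phrased as p = q + 1 so that there is no cochain
   in degree -1. *)
Definition cohomology_neq0 (R : nzRingType) (U : {set 'I_d} -> Prop)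
    (p : nat) : Prop :=
  exists c : {set 'I_d} -> R,
    [/\ cochain_on U p c, forall T, coboundary c T = 0
      & ~ exists b : {set 'I_d} -> R,
          (forall S, b S != 0 -> #|S|.+1 = p /\ U S) /\
          forall T, c T = coboundary b T].

Lemma eq_cohomology_neq0 (R : nzRingType) (U V : {set 'I_d} -> Prop) p :
  (forall S, U S <-> V S) -> cohomology_neq0 R U p -> cohomology_neq0 R V p.
Proof.
move=> UV [c [cU dc0 nb]]; exists c; split=> //.
  by move=> S /cU [-> /UV].
by move=> [b [bV cb]]; apply: nb; exists b; split=> // S /bV [-> /UV].
Qed.

Lemma cohomology_neq0_le (R : nzRingType) (U : {set 'I_d} -> Prop) p :
  cohomology_neq0 R U p -> (p <= d)%N.
Proof.
move=> [c [cU _ nb]]; rewrite leqNgt; apply/negP => ltdp; apply: nb.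
exists (fun=> 0); split=> [S|T]; first by rewrite eqxx.
rewrite /coboundary big1 => [|t _]; last by rewrite mulr0.
apply/eqP; apply: contraTT ltdp => /cU [<- _].
by rewrite -leqNgt -[leqRHS]card_ord max_card.
Qed.

(* The cochain b below contracts the cone towards its apex [j]. *)
Lemma cone_acyclic (R : comNzRingType) (U : {set 'I_d} -> Prop) p (j : 'I_d) :
  (forall S, U (j |: S)%SET -> U S) -> ~ cohomology_neq0 R U p.
Proof.
move=> coneU [c [cU dc0]]; apply.
pose sg T (t : 'I_d) : R := (-1) ^+ #|[set s in T | (s < t)%N]%SET|.
have sgsq T t : sg T t * sg T t = 1 by rewrite -expr2 sqrr_sign.
(* Deleting [u] flips the sign attached to [t] exactly when [u < t]. *)
have sgD1 T (t u : 'I_d) : u \in T ->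
    sg T t = (-1) ^+ (u < t)%N * sg (T :\ u)%SET t.
  move=> uT; rewrite /sg -exprD; congr (_ ^+ _).
  rewrite (cardsD1 u) inE uT /=; congr (_ + _)%N.
  by apply: eq_card => s; rewrite !inE andbA.
pose b S : R := if j \in S then 0 else sg S j * c (j |: S)%SET.
exists b; split=> [S|T].
  rewrite /b; case: ifPn => [_|jS]; first by rewrite eqxx.
  have [->|cn0 _] := eqVneq (c (j |: S)%SET) 0; first by rewrite mulr0 eqxx.
  by have [cj /coneU Uj] := cU _ cn0; rewrite -cj cardsU1 jS.
have sgj T' : sg T' j = sg (T' :\ j)%SET j.
  have [jT|jT] := boolP (j \in T'); first by rewrite (sgD1 _ _ j) // ltnn mul1r.
  by rewrite [in RHS](finset.setDidPl _) // disjoint_sym disjoints1.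
rewrite /coboundary -/(sg T _).
(* If [j] is in [T], only the deletion of [j] contributes, as [b] vanishes on sets containing
   [j]. *)
have [jT|jT] := boolP (j \in T).
  rewrite (bigD1 j) //= big1 => [|t /andP[tT tj]]; last first.
    by rewrite /b finset.in_setD1 eq_sym tj jT mulr0.
  by rewrite addr0 /b setD11 finset.setD1K // mulrA -/(sg T j) sgj sgsq mul1r.
(* Otherwise the cocycle condition at [j |: T] expresses [c T] through the values of [c] at the sets
   [j |: (T :\ t)]. *)
have := dc0 (j |: T)%SET; rewrite /coboundary (bigD1 j) ?setU11 //=.
rewrite -/(sg (j |: T)%SET j) sgj finset.setU1K // => /eqP;
  rewrite addr_eq0 => /eqP ceq.
have -> : c T = sg T j * (sg T j * c T) by rewrite mulrA sgsq mul1r.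
rewrite ceq mulrN mulr_sumr -sumrN.
rewrite [LHS](eq_bigl (mem T)) => [|t]; last first.
  by rewrite /= in_setU1; case: (eqVneq t j) => [->|] /=;
    rewrite ?(negPf jT) ?andbT.
apply: eq_bigr => t tT.
have tj : t != j by apply: contraNneq jT => <-.
rewrite /b in_setD1 (negPf jT) andbF -/(sg T t) -/(sg (j |: T)%SET t).
rewrite (sgD1 T j t) // (sgD1 (j |: T)%SET t j) ?setU11 // finset.setU1K //.
have -> : ((j |: T) :\ t = j |: (T :\ t))%SET.
  by apply/setP=> s; rewrite !inE; case: (eqVneq s j) => [->|] //=;
    rewrite eq_sym tj.
rewrite /= !mulrA -!mulNr; congr (_ * _).
have [lt|lt|] := ltngtP t j; last by move/val_inj/eqP; rewrite (negPf tj).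
  by rewrite expr1 expr0; ring.
by rewrite expr1 expr0; ring.
Qed.

(** The indicator of the full set is a cocycle, because no set is larger, and not a coboundary,
    because no set of size [d - 1] is admissible. *)
Lemma top_cohomology_neq0 (R : nzRingType) (U : {set 'I_d} -> Prop) :
  (forall S, U S <-> S = [set: 'I_d]%SET) -> cohomology_neq0 R U d.
Proof.
move=> UT; exists (fun S => (S == [set: 'I_d]%SET)%:R : R); split.
- move=> S; have [-> _|_] := eqVneq S [set: 'I_d]%SET; last by rewrite eqxx.
  by rewrite cardsT card_ord; split=> //; apply/UT.
- move=> T; apply: big1 => t _.
  have [Tt|] := eqVneq (T :\ t)%SET [set: 'I_d]%SET; last by rewrite mulr0.
  by have := finset.in_setT t; rewrite -Tt setD11.
move=> [b [bU /(_ [set: 'I_d]%SET)]];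
  rewrite eqxx /coboundary big1 => [/eqP|t _].
  by rewrite oner_eq0.
have [->|] := eqVneq (b ([set: 'I_d] :\ t)%SET) 0; first by rewrite mulr0.
by move=> /bU [_ /UT] Tt; have := finset.in_setT t; rewrite -Tt setD11.
Qed.

End SetCochains.

(** * The fine grading of the Cech complex of a monomial ideal *)

Section CoboundaryLinear.
Context {d : nat}.

Lemma coboundary_map (R R' : nzRingType) (f : {additive R -> R'})
    (c : {set 'I_d} -> R) T : coboundary (f \o c) T = f (coboundary c T).
Proof. by rewrite raddf_sum; apply: eq_bigr => t _; rewrite raddfMsign. Qed.

Lemma coboundary_sum (R : nzRingType) (I : finType)
    (c : I -> {set 'I_d} -> R) T :
  coboundary (fun S => \sum_i c i S) T = \sum_i coboundary (c i) T.
Proof.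
rewrite exchange_big; apply: eq_bigr => t _.
by rewrite mulr_sumr; apply: eq_bigr.
Qed.

Lemma eq_coboundary (R : nzRingType) (c c' : {set 'I_d} -> R) T :
  c =1 c' -> coboundary c T = coboundary c' T.
Proof. by move=> cc'; apply: eq_bigr => t _; rewrite cc'. Qed.

End CoboundaryLinear.

Section MultigradedCech.
Context {K : fieldType} {d : nat}.
Notation A := {mpoly K[d]}.
Implicit Types (S T : {set 'I_d}) (m g : 'X_{1..d}) (E : 'X_{1..d} -> Prop).

Definition monomial_span E : set A := fun f => forall m, m \in msupp f -> E m.

(* The degree [al] component of the localization at [var_prod S] of the ideal
   spanned by the monomials with exponent in [E] is K if this holds, and 0
   otherwise. *)
Definition localized_support E (al : 'I_d -> int) S : Prop :=
  exists M g, E g /\ forall j, (g j)%:Z = al j + (M * (j \in S))%N%:Z.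

Definition mset (N : nat) S : 'X_{1..d} := [multinom (N * (j \in S))%N | j < d].

Local Notation full_mset N := (mset N [set: 'I_d]%SET).

Lemma var_prodXn S N : var_prod S ^+ N = 'X_[mset N S] :> A.
Proof.
rewrite mpolyXE_id /var_prod -prodrXl big_mkcond; apply: eq_bigr => j _.
by rewrite mnmE; case: ifP; rewrite (muln1, muln0) // expr0.
Qed.

Lemma mdeg_mset N S : mdeg (mset N S) = (N * #|S|)%N.
Proof.
rewrite mdegE (eq_bigr (fun j => N * (j \in S))%N) => [|j _];
  last by rewrite mnmE.
by rewrite -big_distrr /= -sum1_card [in RHS]big_mkcond; congr muln;
  apply: eq_bigr => j _; case: (j \in S).
Qed.

Lemma mpolyXF_neq0 m : tofrac ('X_[m] : A) != 0.
Proof. by rewrite tofrac_eq0 -msupp_eq0 msuppX. Qed.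

(** Laurent polynomials are written over the fixed denominator (x_1 ... x_d)^N, so that elements of
    all the localizations are compared through their numerators. *)
Definition laurent N (f : A) : {fraction A} :=
  tofrac f / tofrac 'X_[full_mset N].

Lemma laurent_is_additive N : zmod_morphism (laurent N).
Proof. by move=> f g; rewrite /laurent rmorphB mulrBl. Qed.
HB.instance Definition _ N :=
  GRing.isZmodMorphism.Build A {fraction A} (laurent N) (laurent_is_additive N).

Definition laurent_monomial N m (c : K) : {fraction A} :=
  laurent N (c *: 'X_[m]).

Lemma laurent_monomial_is_additive N m : zmod_morphism (laurent_monomial N m).
Proof. by move=> b c; rewrite /laurent_monomial scalerBl raddfB. Qed.
HB.instance Definition _ N m :=
  GRing.isZmodMorphism.Build K {fraction A} (laurent_monomial N m)
    (laurent_monomial_is_additive N m).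

Lemma laurent_inj N : injective (laurent N).
Proof.
move=> f g /(congr1 (fun z => z * tofrac 'X_[full_mset N])).
by rewrite !divfK ?mpolyXF_neq0 // => /eqP; rewrite tofrac_eq => /eqP.
Qed.

Lemma laurent_shift N M m c :
  laurent_monomial N m c = laurent_monomial (N + M) (m + full_mset M) c.
Proof.
have NM : full_mset (N + M) = (full_mset N + full_mset M)%MM.
  by apply/mnmP=> j; rewrite mnmDE !mnmE mulnDl.
rewrite /laurent_monomial /laurent NM !mpolyXD scalerAl !rmorphM /= -mulf_div
  divff ?mulr1 //.
exact: mpolyXF_neq0.
Qed.

(** The exponent in Z^d of the Laurent monomial x^m / (x_1 ... x_d)^N. *)
Definition exponent_shift N m : 'I_d -> int := fun j => (m j)%:Z - N%:Z.

Section MonomialIdeal.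
Variable E : 'X_{1..d} -> Prop.
Hypothesis EU : forall m g, E m -> E (m + g)%MM.

Lemma monomial_span0 : monomial_span E 0.
Proof. by move=> m; rewrite msupp0. Qed.

Lemma monomial_spanD (f g : A) :
  monomial_span E f -> monomial_span E g -> monomial_span E (f + g).
Proof.
by move=> Ef Eg m /msuppD_le; rewrite mem_cat => /orP[/Ef|/Eg].
Qed.

Lemma monomial_spanM (f g : A) : monomial_span E g -> monomial_span E (f * g).
Proof.
move=> Eg m /msuppM_le /allpairsP[[m1 m2] /= [_ /Eg Em2 ->]].
by rewrite addmC; apply: EU.
Qed.

Lemma localization_deg0 S n : localization_deg (monomial_span E) S n 0.
Proof.
exists 0%N, 0; split; [exact: monomial_span0|by move=> m; rewrite msupp0|].
by rewrite rmorph0 mul0r.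
Qed.

Lemma localization_degD S n y z :
    localization_deg (monomial_span E) S n y ->
    localization_deg (monomial_span E) S n z ->
  localization_deg (monomial_span E) S n (y + z).
Proof.
move=> [N [f [Ef degf ->]]] [M [g [Eg degg ->]]].
exists (N + M)%N, (f * var_prod S ^+ M + g * var_prod S ^+ N); split.
- by apply: monomial_spanD; rewrite mulrC; apply: monomial_spanM.
- move=> m /msuppD_le; rewrite mem_cat !var_prodXn !(perm_mem (msuppMX _ _)).
  by case/orP=> /mapP[m' m'f ->]; rewrite mdegD mdeg_mset;
    [have := degf _ m'f|have := degg _ m'f]; lia.
rewrite exprD rmorphD !rmorphM /= addf_div //.
  by rewrite var_prodXn mpolyXF_neq0.
by rewrite var_prodXn mpolyXF_neq0.
Qed.

Lemma localization_deg_sum (I : finType) (z : I -> {fraction A}) S n :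
    (forall i, localization_deg (monomial_span E) S n (z i)) ->
  localization_deg (monomial_span E) S n (\sum_i z i).
Proof.
by move=> ?; elim/big_rec: _ => [|i y _ ?];
  [apply: localization_deg0|apply: localization_degD].
Qed.

(** A fraction over x_S^N0 expands to the denominator (x_1 ... x_d)^N. Allowing every [N >= N0]
    gives the finitely many values of a cochain a common denominator. *)
Lemma localization_deg_laurent S n z :
    localization_deg (monomial_span E) S n z ->
  exists N0, forall N, (N0 <= N)%N -> exists f : A, z = laurent N f /\
    forall m, m \in msupp f -> (mdeg m)%:Z = n + (N * d)%N%:Z /\
      localized_support E (exponent_shift N m) S.
Proof.
move=> [N0 [f [Ef degf ->]]]; exists N0 => N leN.
pose h : 'X_{1..d} := [multinom N - N0 * (j \in S) | j < d]%N.
have hE : (h + mset N0 S = full_mset N)%MM.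
  by apply/mnmP=> j; rewrite mnmDE !mnmE finset.in_setT; case: (j \in S); lia.
exists (f * 'X_[h]); split.
  rewrite /laurent -hE mpolyXD !rmorphM /= [X in _ = _ / X]mulrC -mulf_div
    divff ?mulr1 ?var_prodXn //.
  exact: mpolyXF_neq0.
move=> m; rewrite (perm_mem (msuppMX _ _)) => /mapP[g gf ->]; split.
  have /(congr1 (@mdeg _)) := hE; have := degf _ gf.
  by rewrite !mdegD !mdeg_mset cardsT card_ord; lia.
exists N0, g; split=> [|j]; first exact: Ef.
by rewrite /exponent_shift mnmDE mnmE; case: (j \in S); lia.
Qed.

Lemma laurent_localization_deg S n N m c :
    (c != 0 -> (mdeg m)%:Z = n + (N * d)%N%:Z /\
      localized_support E (exponent_shift N m) S) ->
  localization_deg (monomial_span E) S n (laurent_monomial N m c).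
Proof.
have [->|_ /(_ isT)[degm [M [g [Eg gE]]]]] := eqVneq c 0.
  by rewrite raddf0 => _; apply: localization_deg0.
have mgE : (m + mset M S = g + full_mset N)%MM.
  apply/mnmP=> j; rewrite !mnmDE !mnmE finset.in_setT; have := gE j.
  by rewrite /exponent_shift; case: (j \in S); lia.
exists M, (c *: 'X_[g]); split.
- by move=> m' /msuppZ_le; rewrite msuppX inE => /eqP ->.
- move=> m' /msuppZ_le; rewrite msuppX inE => /eqP ->.
  have /(congr1 (@mdeg _)) := mgE.
  by rewrite !mdegD !mdeg_mset cardsT card_ord; lia.
rewrite /laurent_monomial /laurent var_prodXn; apply/eqP.
rewrite eqr_div ?mpolyXF_neq0 // -!rmorphM /= -!scalerAl -!mpolyXD.
by rewrite mgE.
Qed.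

Lemma cech_cochain_laurent p n c : cech_cochain (monomial_span E) p n c ->
  exists N0, forall N, (N0 <= N)%N -> exists f : {set 'I_d} -> A, forall S,
    c S = laurent N (f S) /\
    forall m, m \in msupp (f S) -> [/\ #|S|%:Z = p,
      (mdeg m)%:Z = n + (N * d)%N%:Z &
      localized_support E (exponent_shift N m) S].
Proof.
move=> cp.
have /choice[N0 N0P] S : exists N0, forall N, (N0 <= N)%N ->
    exists f : A, c S = laurent N f /\
    forall m, m \in msupp f -> [/\ #|S|%:Z = p,
      (mdeg m)%:Z = n + (N * d)%N%:Z &
      localized_support E (exponent_shift N m) S].
  have := cp S; case: eqP => [Sp /localization_deg_laurent[N0 N0P]|_ ->].
    exists N0 => N /N0P[f [cS fP]]; exists f; split=> // m /fP[]; by split.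
  exists 0%N => N _; exists 0; rewrite raddf0; split=> // m; by rewrite msupp0.
exists (\max_S N0 S)%N => N leN.
have /choice[f fP] S := N0P S N (leq_trans (leq_bigmax S) leN).
by exists f.
Qed.

(** The Cech complex splits into its Z^d-graded components, and a cochain meets only finitely many
    of them; those of total degree [n] make up degree [n]. *)
Theorem local_cohomology_multigraded i n :
  local_cohomology_neq0 (monomial_span E) i n <->
  exists al : 'I_d -> int, \sum_j al j = n /\
    cohomology_neq0 K (localized_support E al) i.
Proof.
split.
  move=> [c [ci dc0 nb]]; apply: contrapT => nH; apply: nb.
  have [N] := cech_cochain_laurent ci; move=> /(_ _ (leqnn N))[f fP].
  have df0 T : coboundary f T = 0.
    apply: (@laurent_inj N); rewrite raddf0 -[RHS](dc0 T) -coboundary_map.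
    by apply: eq_coboundary => S; rewrite /= -(fP S).1.
  (* Each coefficient of the numerators is a cocycle in a single multidegree, hence has a primitive;
     in the wrong total degree it is zero. *)
  have /choice[b bP] m : exists b : {set 'I_d} -> K,
      (forall S, b S != 0 -> [/\ #|S|.+1 = i, (mdeg m)%:Z = n + (N * d)%N%:Z &
        localized_support E (exponent_shift N m) S]) /\
      forall T, (f T)@_m = coboundary b T.
    have [degm|/eqP degm] := eqVneq (mdeg m)%:Z (n + (N * d)%N%:Z); last first.
      exists (fun=> 0); split=> [S|T]; first by rewrite eqxx.
      rewrite /coboundary big1 => [|t _]; last by rewrite mulr0.
      by apply: memN_msupp_eq0; apply/negP => /(fP T).2[].
    apply: contrapT => nb; apply: nH; exists (exponent_shift N m); split.
      rewrite big_split /= -(big_morph _ PoszD (erefl _)) -mdegE sumr_const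
        card_ord degm.
      by lia.
    exists (fun S => (f S)@_m); split.
    - move=> S; rewrite -mcoeff_msupp => /(fP S).2[[Si] _ ?]; by split.
    - by move=> T; rewrite (coboundary_map (mcoeff m)) df0 raddf0.
    by move=> [b [bU fb]]; apply: nb; exists b; split=> // S /bU[]; split.
  (* [k] bounds the degrees of all numerators, so the primitives are summed over a finite type of
     exponents. *)
  pose k := (\max_S msize (f S))%N.
  exists (fun S => \sum_(m : 'X_{1..d < k}) laurent_monomial N m (b m S)).
  split=> [S|T].
    case: eqP => Si.
      apply: localization_deg_sum => m; apply: laurent_localization_deg.
      by move=> /(bP m).1[].
    apply: big1 => m _; have [->|/(bP m).1[Si']] := eqVneq (b m S) 0.
      by rewrite raddf0.
    by move: Si; rewrite -Si'; lia.
  rewrite (fP T).1 {1}(@mpolywE _ _ k (f T)) ?leq_bigmax // raddf_sum /=.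
  rewrite -[RHS]/(coboundary _ T) coboundary_sum; apply: eq_bigr => m _.
  by rewrite (bP m).2 -[LHS]/(laurent_monomial N m _) -coboundary_map.
(* Conversely, a cocycle in multidegree [al] is carried by the monomial x^al, where [N0] clears the
   negative entries of [al]. *)
move=> [al [sumal [c [ci dc0 nb]]]].
pose N0 := (\sum_j absz (al j))%N.
pose m := [multinom absz (al j + N0%:Z)%R | j < d].
have leN0 j : (absz (al j) <= N0)%N by rewrite /N0 (bigD1 j) //= leq_addr.
have mE M : exponent_shift (N0 + M) (m + full_mset M) = al.
  apply/funext=> j; have := leN0 j.
  by rewrite /exponent_shift mnmDE !mnmE finset.in_setT; lia.
have mE0 : exponent_shift N0 m = al.
  by apply/funext=> j; have := leN0 j; rewrite /exponent_shift !mnmE; lia.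
have degm : (mdeg m)%:Z = n + (N0 * d)%N%:Z.
  rewrite -sumal -mE0 big_split /= -(big_morph _ PoszD (erefl _)) -mdegE
    sumr_const card_ord.
  by lia.
exists (laurent_monomial N0 m \o c); split.
- move=> S; case: eqP => Si.
    by apply: laurent_localization_deg => /ci[_ ?]; rewrite mE0.
  rewrite /=; have [->|/ci[Si']] := eqVneq (c S) 0; first by rewrite raddf0.
  by case: Si; rewrite Si'.
- by move=> T; rewrite -[LHS]/(coboundary _ T) coboundary_map dc0 raddf0.
move=> [b [/cech_cochain_laurent[N1 N1P] cb]]; apply: nb.
have [f fP] := N1P _ (leq_addl N0 N1).
(* The coefficients of x^al in a primitive of the new cochain form a primitive of [c]. *)
exists (fun S => (f S)@_(m + full_mset N1)); split=> [S|T].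
  rewrite -mcoeff_msupp => /(fP S).2[Si _]; rewrite mE; split=> //.
  by lia.
rewrite (coboundary_map (mcoeff _)).
have <- : c T *: 'X_[m + full_mset N1] = coboundary f T.
  apply: (@laurent_inj (N0 + N1));
    rewrite -[LHS]/(laurent_monomial _ _ _) -laurent_shift.
  rewrite -[LHS]/((laurent_monomial N0 m \o c) T) cb -coboundary_map.
  by apply: eq_coboundary => S; rewrite /= -(fP S).1.
by rewrite /= mcoeffZ mcoeffX eqxx mulr1.
Qed.

End MonomialIdeal.
End MultigradedCech.

(** * Ideals cut out by weights *)

Section WeightedIdeals.
Context {K : fieldType} {d : nat} {I : finType}.
Variable w : I -> 'I_d -> nat.
Implicit Types (S T : {set 'I_d}) (m g : 'X_{1..d}) (al : 'I_d -> int).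

Definition heavy n m : Prop := forall i, (n <= \sum_j w i j * m j)%N.

Lemma heavyD n m g : heavy n m -> heavy n (m + g)%MM.
Proof.
move=> nm i; apply: leq_trans (nm i) _; apply: leq_sum => j _.
by rewrite mnmDE leq_mul2l leq_addr orbT.
Qed.

Definition weighted_support n al S : Prop :=
  (forall j, j \notin S -> 0 <= al j) /\
  forall i, (exists2 j, j \in S & (0 < w i j)%N) \/
            n%:Z <= \sum_j (w i j)%:Z * al j.

(** A power of x_S raises any weight that is positive somewhere on [S] as far as needed, and leaves
    the other weights unchanged. *)
Lemma localized_supportE n al S :
  localized_support (heavy n) al S <-> weighted_support n al S.
Proof.
split=> [[M [g [ng gE]]]|[al0 nal]].
  split=> [j /negPf jS|i].
    have -> : al j = g j by rewrite gE jS muln0 addr0.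
    by [].
  have [[j jS wj]|w0] := pselect (exists2 j, j \in S & (0 < w i j)%N).
    by left; exists j.
  right; have /(congr1 Posz) :
    (\sum_j w i j * g j)%N = (\sum_j w i j * g j)%N by [].
  rewrite [RHS](big_morph _ PoszD (erefl _)) => sumE.
  rewrite (eq_bigr (fun j => (w i j * g j)%N%:Z)) -?sumE ?lez_nat // => j _.
  rewrite PoszM gE; have [jS|jS] := boolP (j \in S);
    last by rewrite muln0 addr0.
  have [->|wj] := posnP (w i j); last by case: w0; exists j.
  by rewrite !mul0r.
(* The last sum makes [al j + M] nonnegative; the first two terms let a single positive weight on
   [S] outweigh all negative contributions and reach [n]. *)
pose M := (n + \sum_i \sum_j w i j * absz (al j) + \sum_j absz (al j))%N.
have alM j : (absz (al j) <= M)%N.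
  by apply: leq_trans (leq_addl _ _); rewrite (bigD1 j) //= leq_addr.
pose g := [multinom absz (al j + (M * (j \in S))%N%:Z)%R | j < d].
have gE j : (g j)%:Z = al j + (M * (j \in S))%N%:Z.
  rewrite mnmE; have [jS|/al0 al0j] := boolP (j \in S); last by lia.
  by have := alM j; lia.
exists M, g; split=> // i; rewrite -lez_nat (big_morph _ PoszD (erefl _)).
rewrite (eq_bigr (fun j => (w i j)%:Z * al j +
    (w i j * (M * (j \in S)))%N%:Z)); last first.
  by move=> j _; rewrite PoszM gE mulrDr -PoszM.
rewrite big_split /=; case: (nal i) => [[j jS wj]|/le_trans->//]; last first.
  by rewrite lerDl; apply: sumr_ge0.
have leM : (n + \sum_j w i j * absz (al j) <= M)%N.
  by apply: leq_trans (leq_addr _ _); rewrite leq_add2l (bigD1 i) //= leq_addr.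
have le1 : - (\sum_j w i j * absz (al j))%N%:Z <= \sum_j (w i j)%:Z * al j.
  rewrite (big_morph _ PoszD (erefl _)) -sumrN; apply: ler_sum => k _.
  by rewrite PoszM -mulrN ler_wpM2l //; lia.
have le2 : M%:Z <= \sum_j0 (w i j0 * (M * (j0 \in S)))%N%:Z.
  rewrite (bigD1 j) //= jS muln1 -[leLHS]addr0 lerD ?sumr_ge0 //.
  by rewrite lez_nat leq_pmull.
apply: le_trans (lerD le1 le2); move: leM; move: (\sum_j _)%N => c; lia.
Qed.

Definition weighted_cohomology n al p : Prop :=
  cohomology_neq0 K (weighted_support n al) p.

Lemma local_cohomology_weighted n p k :
  local_cohomology_neq0 (@monomial_span K d (heavy n)) p k <->
  exists al, \sum_j al j = k /\ weighted_cohomology n al p.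
Proof.
rewrite (local_cohomology_multigraded (@heavyD n)).
by split=> -[al [sumal H]]; exists al; split=> //;
  apply: eq_cohomology_neq0 H => S; rewrite localized_supportE.
Qed.

Lemma ceil_divP (n m : nat) (z : int) :
  (0 < m)%N -> ((ceil_div n m)%:Z <= z) = (n%:Z <= m%:Z * z).
Proof.
move=> m0; rewrite /ceil_div /dvdn.
by have := divn_eq n m; have := ltn_pmod n m0; case: eqP => /=; nia.
Qed.

(** Scaling by [m] keeps signs, and since w . al is an integer, being at least the ceiling of n / m
    amounts to w . (m al) >= n: the two supports coincide. *)
Lemma weighted_cohomologyM n (m : nat) al p : (0 < m)%N ->
  weighted_cohomology (ceil_div n m) al p ->
  weighted_cohomology n (fun j => m%:Z * al j) p.
Proof.
move=> m0; apply: eq_cohomology_neq0 => S; rewrite /weighted_support.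
have -> : (forall j, j \notin S -> 0 <= al j) <->
    (forall j, j \notin S -> 0 <= m%:Z * al j).
  by split=> al0 j /al0; rewrite pmulr_rge0.
suff E i : (n%:Z <= \sum_j (w i j)%:Z * (m%:Z * al j)) =
    ((ceil_div n m)%:Z <= \sum_j (w i j)%:Z * al j).
  by split=> -[? H]; split=> // i; have := H i; rewrite E.
rewrite ceil_divP // mulr_sumr; congr (_ <= _).
by apply: eq_bigr => j _; rewrite mulrCA.
Qed.

(** If [al j >= n], the admissible sets form a cone with apex [j]: a weight that meets [j |: S] only
    in [j] already has value at least [n] at [al]. *)
Lemma weighted_cohomology_lt n al p j : (0 < n)%N ->
  weighted_cohomology n al p -> al j < n%:Z.
Proof.
move=> n0 H; rewrite ltNge; apply/negP => naj.
apply: (cone_acyclic (j := j)) H => S [al0 nal]; split=> [k kS|i].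
  have [->|kj] := eqVneq k j; first by apply: le_trans naj.
  by apply: al0; rewrite !inE negb_or kj.
case: (nal i) => [[k kS wk]|]; last by right.
have [[h ? ?]|w0] := pselect (exists2 j, j \in S & (0 < w i j)%N).
  by left; exists h.
have kj : k = j.
  by apply/eqP; move: kS; rewrite !inE => /orP[//|kS]; case: w0; exists k.
(* The terms other than [j] are nonnegative: off [S] by the sign of [al], on [S] because [w i]
   vanishes there. *)
right; rewrite (bigD1 j) //= -[leLHS]addr0 lerD ?sumr_ge0 //.
  by move: wk; rewrite kj; nia.
move=> h hj; have [hS|hS] := boolP (h \in S); last first.
  by apply: mulr_ge0 => //; apply: al0; rewrite !inE negb_or hj.
case: (posnP (w i h)) => [->|wh]; first by rewrite mul0r.
by case: w0; exists h.
Qed.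

Lemma weighted_cohomology_sum_le n al p : (0 < n)%N ->
  weighted_cohomology n al p -> \sum_j al j <= (d * n.-1)%N%:Z.
Proof.
move=> n0 H; apply: (@le_trans _ _ (\sum_(j < d) n.-1%:Z)).
  by apply: ler_sum => j _; have := weighted_cohomology_lt j n0 H; lia.
by rewrite sumr_const card_ord; lia.
Qed.

(** Negative entries everywhere leave only the full set, which every nonzero weight meets. This
    keeps the regularity above -oo and the set of means nonempty. *)
Lemma weighted_cohomology_top n : (forall i, exists j, (0 < w i j)%N) ->
  weighted_cohomology n (fun=> -1) d.
Proof.
move=> w0; apply: top_cohomology_neq0 => S; split=> [[S0 _]|->].
  apply/setP=> j; rewrite finset.in_setT; apply: contraT => /S0.
  by rewrite ler0N1.
split=> [j|i]; first by rewrite finset.in_setT.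
by have [j wj] := w0 i; left; exists j.
Qed.

(* Rounding [n / m * al] up keeps every sign condition and every inequality
   [m <= w . al]; it keeps their negations once [n] is large. *)
Lemma weighted_cohomology_ceil (m : nat) al p : (0 < m)%N ->
  weighted_cohomology m al p ->
  exists n0, forall n, (n0 <= n)%N -> exists be : 'I_d -> int,
    weighted_cohomology n be p /\ n%:Z * \sum_j al j <= m%:Z * \sum_j be j.
Proof.
(* The summand [m] keeps negative entries negative after rounding. The other one keeps the weighted
   rounding error, at most m times the sum of the [w i j], below [n], so that w . al <= m - 1 still
   gives w . be < n. *)
move=> m0 H; exists (m + m * \sum_i \sum_j w i j).+1%N => n len.
have /choice[be beP] j : exists b : int,
    n%:Z * al j <= m%:Z * b /\ m%:Z * b < n%:Z * al j + m%:Z.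
  (* The ceiling of n al_j / m, as the opposite of a floor. *)
  exists (- ((- (n%:Z * al j)) %/ m)%Z).
  have := divz_eq (- (n%:Z * al j)) m; have := @ltz_pmod (- (n%:Z * al j)) m.
  by have := @modz_ge0 (- (n%:Z * al j)) m; lia.
exists be; split; last first.
  by rewrite !mulr_sumr; apply: ler_sum => j _; have [] := beP j.
apply: eq_cohomology_neq0 H => S; rewrite /weighted_support.
have -> : (forall j, j \notin S -> 0 <= al j) <->
    (forall j, j \notin S -> 0 <= be j).
  by split=> H j /H; have [] := beP j; nia.
suff E i : (m%:Z <= \sum_j (w i j)%:Z * al j) =
    (n%:Z <= \sum_j (w i j)%:Z * be j).
  by split=> -[? H]; split=> // i; have := H i; rewrite E.
have le1 : n%:Z * \sum_j (w i j)%:Z * al j <= m%:Z * \sum_j (w i j)%:Z * be j.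
  rewrite !mulr_sumr; apply: ler_sum => j _; rewrite mulrCA [leRHS]mulrCA.
  by apply: ler_wpM2l => //; have [] := beP j.
have le2 : m%:Z * \sum_j (w i j)%:Z * be j <=
    n%:Z * (\sum_j (w i j)%:Z * al j) + m%:Z * (\sum_j w i j)%N%:Z.
  rewrite (big_morph _ PoszD (erefl _)) !mulr_sumr -big_split;
    apply: ler_sum => j _.
  rewrite mulrCA /= [n%:Z * _]mulrCA [m%:Z * (w i j)%:Z]mulrC -mulrDr.
  by apply: ler_wpM2l => //; have [_ /ltW] := beP j.
have wi : (\sum_j w i j <= \sum_i \sum_j w i j)%N
  by rewrite (bigD1 i) //= leq_addr.
have {}len : (m * \sum_j w i j < n)%N.
  apply: leq_trans len; rewrite ltnS; apply: leq_trans (leq_addl _ _).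
  by rewrite leq_mul2l wi orbT.
move: (\sum_j _ * al j) (\sum_j _ * be j) (\sum_j w i j)%N le1 le2 len =>
  a b c le1 le2 len.
by apply/idP/idP; nia.
Qed.

End WeightedIdeals.

Local Open Scope classical_set_scope.

(** * Growth of the a-invariants and limit of the regularity *)

Section WeightedFiltrations.
Context {R : realType} {K : fieldType} {d : nat} {I : finType}.
Variable w : I -> 'I_d -> nat.
Variable F : nat -> set {mpoly K[d]}.
Hypothesis FE : forall n, (0 < n)%N -> F n = monomial_span (heavy w n).

Notation H n := (@weighted_cohomology K d I w n).
Notation mean n al := ((\sum_j al j)%:~R / n%:R : R).

Lemma weighted_growth : a_invariant_growth R F.
Proof.
move=> n m p n0 m0 _.
have c0 : (0 < ceil_div n m)%N.
  by rewrite -ltz_nat ltNge ceil_divP // mulr0 -ltNge.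
rewrite -lee_pdivlMl ?ltr0n //; apply: ge_ereal_sup => _ [k Hk <-].
rewrite lee_pdivlMl ?ltr0n //; apply: ereal_sup_ubound.
move: Hk; rewrite !FE //= => /local_cohomology_weighted[al [<- Hal]].
exists (m%:Z * \sum_j al j); last by rewrite -EFinM intrM.
apply/local_cohomology_weighted; exists (fun j => m%:Z * al j).
by rewrite mulr_sumr; split=> //; apply: weighted_cohomologyM.
Qed.

Lemma regularity_ge n al p : (0 < n)%N -> H n al p ->
  ((\sum_j al j)%:~R%:E <= regularity R (F n))%E.
Proof.
move=> n0 Hal; apply: (@le_trans _ _ (a_invariant R (F n) p + p%:R%:E)%E).
  apply: (@le_trans _ _ (a_invariant R (F n) p)); last first.
    by rewrite leeDl // lee_fin.
  apply: ereal_sup_ubound; exists (\sum_j al j) => //.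
  by rewrite FE //; apply/local_cohomology_weighted; exists al.
by apply: ereal_sup_ubound; exists p.
Qed.

(** Cohomology vanishes above degree [d], so the shift by [p] costs at most [d], which is negligible
    after division by [n]. *)
Lemma regularity_le n (B : R) : (0 < n)%N ->
  (forall al p, H n al p -> (\sum_j al j)%:~R <= B) ->
  (regularity R (F n) <= (B + d%:R)%:E)%E.
Proof.
move=> n0 HB; apply: ge_ereal_sup => _ [p _ <-].
have [pd|dp] := leqP p d.
  rewrite EFinD leeD ?lee_fin ?ler_nat //.
  apply: ge_ereal_sup => _ [k + <-];
    rewrite FE // => /local_cohomology_weighted.
  by move=> [al [<- /HB]]; rewrite lee_fin.
rewrite (_ : a_invariant _ _ _ = -oo%E) ?addNye ?leNye //.
rewrite /a_invariant -ereal_sup0; congr ereal_sup; apply/seteqP;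
  split=> // x [k + _].
rewrite FE // => /local_cohomology_weighted[al [_ /cohomology_neq0_le]].
by rewrite leqNgt dp.
Qed.

(** For n > 0 a zero weight satisfies neither alternative of [weighted_support]: no set is
    admissible and all local cohomology vanishes. *)
Lemma weighted_regularity_limit_degenerate i : (forall j, w i j = 0%N) ->
  regularity_limit_exists R F.
Proof.
move=> w0; exists -oo%E.
have nheavy n m : (0 < n)%N -> ~ heavy w n m.
  move=> n0 /(_ i); rewrite big1 => [|j _]; last by rewrite w0.
  by rewrite leqNgt n0.
split; last first.
  right; split=> //; rewrite FE //; apply/seteqP; split=> [f ff|_ ->] /=.
    apply: msuppnil0; case E: (msupp f) => [//|m s].
    by case: (nheavy 1%N m) => //; apply: ff; rewrite E mem_head.
  exact: monomial_span0.
apply: cvg_near_cst; exists 1%N => // n /= n0.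
rewrite (_ : regularity _ _ = -oo%E) ?mulNyr ?gtr0_sg ?invr_gt0 ?ltr0n //
  ?mul1e //.
apply/eqP; rewrite -leeNy_eq; apply: ge_ereal_sup => _ [p _ <-].
rewrite (_ : a_invariant _ _ _ = -oo%E) ?addNye //.
rewrite /a_invariant -ereal_sup0; congr ereal_sup; apply/seteqP;
  split=> // x [k + _].
rewrite FE // => /local_cohomology_weighted[al [_ [c [cU _ nb]]]].
have c0 S : c S = 0.
  apply/eqP; apply: contraT => /cU[_ [_ /(_ i)]].
  case=> [[j]|]; rewrite ?w0 // big1 => [|j _]; last by rewrite w0 mul0r.
  by rewrite lez_nat leqNgt n0.
apply: nb; exists (fun=> 0); split=> [S|T]; first by rewrite eqxx.
by rewrite c0 /coboundary big1 // => t _; rewrite mulr0.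
Qed.

Lemma weighted_regularity_limit : regularity_limit_exists R F.
Proof.
have [w0|/existsNP[i /forallNP wi]] :=
    pselect (forall i, exists j, (0 < w i j)%N); last first.
  apply: (weighted_regularity_limit_degenerate (i := i)) => j.
  by apply/eqP; rewrite -leqn0 leqNgt; apply/negP/wi.
pose L : set R := [set x | exists n al p,
  [/\ (0 < n)%N, H n al p & x = mean n al]].
have supL : has_sup L.
  split.
    pose al0 (j : 'I_d) : int := -1.
    exists (mean 1 al0), 1%N, al0, d; split=> //.
    exact: weighted_cohomology_top.
  exists d%:R => _ [n [al [p [n0 Hal ->]]]].
  rewrite ler_pdivrMr ?ltr0n // -natrM -[leRHS]/((d * n)%N%:Z%:~R) ler_int.
  apply: le_trans (weighted_cohomology_sum_le n0 Hal) _.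
  by rewrite lez_nat leq_mul2l leq_pred orbT.
pose s := sup L.
have leLs n al p : (0 < n)%N -> H n al p -> mean n al <= s.
  by move=> n0 Hal; apply: sup_upper_bound => //; exists n, al, p.
exists s%:E; split; last by left.
have reg_le n : (0 < n)%N -> (regularity R (F n) <= (s * n%:R + d%:R)%:E)%E.
  move=> n0; apply: regularity_le => // al p /(leLs _ _ _ n0).
  by rewrite ler_pdivrMr ?ltr0n.
have regfin n : (0 < n)%N -> regularity R (F n) \is a fin_num.
  move=> n0; have := regularity_ge n0 (weighted_cohomology_top _ w0).
  move=> /(lt_le_trans (ltNyr _)) regNy; rewrite fin_numElt regNy /=.
  by rewrite (le_lt_trans (reg_le _ n0)) ?ltry.
pose x n : R := fine (regularity R (F n) * (n%:R^-1)%:E)%E.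
apply: cvg_EFin; first by exists 1%N => // n /= n0; rewrite fin_numM // regfin.
apply/(@cvgrPdist_lt R R^o) => e e0; rewrite /=.
have e20 : 0 < e / 2 by rewrite divr_gt0.
(* A mean within e / 2 of the supremum; rounding up carries it to every large [n] without lowering
   it. *)
have [_ [m [al [p [m0 Hal ->]]]]] := sup_adherent e20 supL.
rewrite -/s => sme.
have [n0 n0P] := weighted_cohomology_ceil m0 Hal.
(* The first bound serves the rounding, the second makes d / n < e in the upper estimate. *)
exists (maxn n0.+1 (Num.bound (d%:R / e))) => // n /=.
rewrite -/(x n) geq_max => /andP[n0n nb].
have n_gt0 : (0 < n)%N by apply: leq_ltn_trans n0n.
have [be [Hbe albe]] := n0P _ (ltnW n0n).
have xn : x n * n%:R = fine (regularity R (F n))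
  by rewrite /x fineM ?regfin //= divfK // pnatr_eq0 -lt0n.
have := regularity_ge n_gt0 Hbe; have := reg_le _ n_gt0.
rewrite -(fineK (regfin _ n_gt0)) !lee_fin -xn => x_le x_ge.
have ngt0 : (0 : R) < n%:R by rewrite ltr0n.
have nm : (\sum_j al j)%:~R / m%:R * n%:R <= (\sum_j be j)%:~R :> R.
  move: albe; rewrite -(ler_int R) !intrM -!pmulrn => albe.
  by rewrite mulrAC ler_pdivrMr ?ltr0n // mulrC [leRHS]mulrC.
have dn : d%:R < e * n%:R.
  rewrite mulrC -ltr_pdivrMr //; apply: lt_le_trans (archi_boundP _) _.
    by rewrite divr_ge0 // ltW.
  by rewrite ler_nat.
rewrite ltr_distlC.
apply/andP; split; rewrite -(ltr_pM2r ngt0) ?mulrBl ?mulrDl; last by lra.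
have : s * n%:R - e / 2 * n%:R < (\sum_j al j)%:~R / m%:R * n%:R.
  by rewrite -mulrBl ltr_pM2r.
have : 0 < e / 2 * n%:R by rewrite mulr_gt0.
lra.
Qed.

End WeightedFiltrations.

(** * Order functions with respect to a weight *)

Section Ideals.
Context {K : fieldType} {d : nat}.
Notation A := {mpoly K[d]}.
Implicit Types (I J : set A) (f g : A) (m : 'X_{1..d}).

Lemma ideal_gen_is_ideal (G : set A) : is_ideal (ideal_gen G).
Proof.
split=> [J JG|f g Hf Hg J JG|f g Hg J JG]; have [[J0 JD JM] _] := JG.
- exact: J0.
- by apply: JD; [exact: Hf|exact: Hg].
by apply: JM; exact: Hg.
Qed.

Lemma ideal_pow_is_ideal I n : is_ideal (ideal_pow I n).
Proof. by case: n => [|n]; [|apply: ideal_gen_is_ideal]. Qed.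

Lemma ideal_powM I n f g : I f -> ideal_pow I n g -> ideal_pow I n.+1 (f * g).
Proof. by move=> If Ig; apply: sub_gen_smallest; exists f, g. Qed.

Lemma ideal_powX I n f : I f -> ideal_pow I n (f ^+ n).
Proof. by move=> If; elim: n => // n IH; rewrite exprS; apply: ideal_powM. Qed.

Lemma ideal_sum I (T : Type) (r : seq T) (P : pred T) (F : T -> A) :
  is_ideal I -> (forall i, P i -> I (F i)) -> I (\sum_(i <- r | P i) F i).
Proof. by move=> [I0 ID _] IF; elim/big_ind: _. Qed.

Lemma ideal_of_terms I f : is_ideal I ->
  (forall m, m \in msupp f -> I 'X_[m]) -> I f.
Proof.
move=> iI If; rewrite [f]mpolyE big_seq; apply: ideal_sum => // m /If.
by case: iI => _ _ IM; rewrite -mul_mpolyC; apply: IM.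
Qed.

Lemma prime_ideal_mpolyX I m : is_prime_ideal I -> I 'X_[m] ->
  exists2 j, (0 < m j)%N & I 'X_j.
Proof.
move=> [[_ _ IM] Ineq IP] Im; apply: contrapT => nj.
have I1 : ~ I 1.
  move=> I1; move/eqP: Ineq; apply; apply/seteqP; split=> // f _.
  by rewrite -[f]mulr1; apply: IM.
move: Im; rewrite mpolyXE_id;
  apply: (big_ind (fun f => ~ I f)) => // [f g nf ng /IP[]//|j _].
have : (0 < m j)%N -> ~ I 'X_j by move=> mj Ij; apply: nj; exists j.
elim: (m j) => [|k IH] nIj; first by rewrite expr0.
rewrite exprS => /IP[|]; first exact: nIj.
by apply: IH => _; apply: nIj.
Qed.

End Ideals.

Section WeightOrder.
Context {K : fieldType} {d : nat}.
Notation A := {mpoly K[d]}.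
Variable u : 'I_d -> nat.
Implicit Types (f g : A) (m : 'X_{1..d}) (k : nat).

Definition weight m := (\sum_j u j * m j)%N.

Lemma weightD m1 m2 : weight (m1 + m2)%MM = (weight m1 + weight m2)%N.
Proof. by rewrite -big_split; apply: eq_bigr => j _; rewrite mnmDE mulnDr. Qed.

Lemma weight0 : weight 0%MM = 0%N.
Proof. by rewrite /weight big1 // => j _; rewrite mnm0E muln0. Qed.

Lemma weightU j : weight U_(j)%MM = u j.
Proof.
rewrite /weight (bigD1 j) //= mnm1E eqxx muln1 big1 ?addn0 // => k kj.
by rewrite mnm1E eq_sym (negPf kj) muln0.
Qed.

(** The condition v(f) >= k for the monomial valuation v with weight vector [u], stated without the
    infinite value at 0. *)
Definition order_ge k : set A := monomial_span (fun m => (k <= weight m)%N).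

Lemma order_ge0 f : order_ge 0 f.
Proof. by []. Qed.

Lemma order_ge_ideal k : is_ideal (order_ge k).
Proof.
split=> [|f g|f g]; [exact: monomial_span0|exact: monomial_spanD|].
apply: monomial_spanM => m1 m2 km1.
by rewrite weightD (leq_trans km1) ?leq_addr.
Qed.

Lemma order_ge_le k l f : (k <= l)%N -> order_ge l f -> order_ge k f.
Proof. by move=> kl lf m /lf; apply: leq_trans. Qed.

Lemma order_geM k l f g : order_ge k f -> order_ge l g ->
  order_ge (k + l) (f * g).
Proof.
move=> kf lg m /msuppM_le/allpairsP[[m1 m2] /= [/kf k1 /lg l2 ->]].
by rewrite weightD leq_add.
Qed.

Lemma order_geX k n f : order_ge k f -> order_ge (n * k) (f ^+ n).
Proof.
by move=> kf; elim: n => // n IH; rewrite exprS mulSn; apply: order_geM.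
Qed.

Lemma order_geXP m k : order_ge k 'X_[m] <-> (k <= weight m)%N.
Proof.
split=> [|km m']; first by apply; rewrite msuppX inE.
by rewrite msuppX inE => /eqP ->.
Qed.

Lemma order_exact k f : ~ order_ge k f ->
  exists2 a, (a < k)%N & order_ge a f /\ ~ order_ge a.+1 f.
Proof.
elim: k => [/(_ (@order_ge0 f))//|k IH] nkf.
have [kf|/IH[a ak]] := pselect (order_ge k f); first by exists k.
by exists a => //; apply: ltn_trans ak _.
Qed.

Definition initial_part a f : A :=
  \sum_(m <- msupp f | weight m == a) f@_m *: 'X_[m].

Lemma mcoeff_initial_part a f m :
  (initial_part a f)@_m = if weight m == a then f@_m else 0.
Proof.
rewrite raddf_sum /=.
under eq_bigr => k _ do rewrite mcoeffZ mcoeffX.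
have [mf|mf] := boolP (m \in msupp f); last first.
  rewrite (memN_msupp_eq0 mf) if_same big_seq_cond big1 // => k /andP[kf _].
  by case: eqP kf => [->|]; rewrite ?(negPf mf) ?mulr0.
rewrite big_mkcond (bigD1_seq m) ?msupp_uniq //= eqxx mulr1 big1
  ?addr0 // => k km.
by rewrite (negPf km) mulr0 if_same.
Qed.

(* The product of the two initial parts is nonzero, and no other product of
   homogeneous parts contributes to its degree. *)
Lemma order_ge_prime a b f g :
  order_ge (a + b).+1 (f * g) -> order_ge a.+1 f \/ order_ge b.+1 g.
Proof.
move=> abfg; apply: contrapT => /not_orP[].
move=> /order_exact[a0 a0a [fa0 nf]] /order_exact[b0 b0b [gb0 ng]].
have part c h : order_ge c h -> ~ order_ge c.+1 h ->
    [/\ initial_part c h != 0, order_ge c.+1 (h - initial_part c h)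
      & forall m, m \in msupp (initial_part c h) -> weight m = c].
  move=> hc nh; split.
  - apply: contra_notN nh => /eqP h0 m mh;
    rewrite ltn_neqAle hc // andbT eq_sym.
    apply/negP => wm; move: mh; rewrite mcoeff_msupp.
    by have := congr1 (mcoeff m) h0;
      rewrite mcoeff_initial_part wm mcoeff0 => ->; rewrite eqxx.
  - move=> m; rewrite mcoeff_msupp mcoeffB mcoeff_initial_part.
    have [_|wm] := eqVneq (weight m) c; first by rewrite subrr eqxx.
    by rewrite subr0 -mcoeff_msupp => /hc; rewrite ltn_neqAle eq_sym wm.
  move=> m; rewrite mcoeff_msupp mcoeff_initial_part.
  by have [|_] := eqVneq (weight m) c; rewrite ?eqxx.
have [fi0 fhi fi] := part _ _ fa0 nf; have [gi0 ghi gi] := part _ _ gb0 ng.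
set F := initial_part a0 f in fi0 fhi fi;
  set G := initial_part b0 g in gi0 ghi gi.
have FGhi : order_ge (a0 + b0).+1 (F * G).
  have -> : F * G = f * g + - 1 * ((f - F) * g + F * (g - G)) by ring.
  have [_ D M] := order_ge_ideal (a0 + b0).+1.
  apply: (D); first by apply: order_ge_le _ abfg; rewrite ltnS leq_add.
  apply/M/D; first by rewrite -addSn; apply: order_geM.
  by rewrite -addnS; apply: order_geM => // m /fi ->.
have : F * G != 0 by rewrite mulf_neq0.
rewrite -msupp_eq0; case E: (msupp (F * G)) => [//|m s] _.
have mFG : m \in msupp (F * G) by rewrite E mem_head.
have := FGhi _ mFG.
have /allpairsP[[m1 m2] /= [/fi <- /gi <- ->]] := msuppM_le mFG.
by rewrite weightD ltnn.
Qed.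

Lemma order_geX_prime a n f :
  (0 < n)%N -> order_ge (n * a).+1 (f ^+ n) -> order_ge a.+1 f.
Proof.
case: n => // n _; elim: n => [|n IH]; first by rewrite mul1n.
by rewrite exprS mulSn => /order_ge_prime[].
Qed.

Lemma order_ge_pow J c n : J `<=` order_ge c ->
  ideal_pow J n `<=` order_ge (n * c).
Proof.
move=> Jc; elim: n => [//|n IH]; apply: smallest_sub (order_ge_ideal _) _.
by move=> _ [f [g [/Jc fc /IH gn ->]]]; rewrite mulSn; apply: order_geM.
Qed.

(** If f had order b < c, each term a_j f^(n-j) with j >= 1 would have order at least jc + (n-j)b >
    nb, and so would f^n, whose order is nb. *)
Lemma order_ge_integral_closure J c : J `<=` order_ge c ->
  integral_closure J `<=` order_ge c.
Proof.
move=> Jc f [n [a [n0 aJ fn]]]; apply: contrapT => /order_exact[b bc [fb]];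
  apply.
apply: (order_geX_prime n0).
have /eqP -> : f ^+ n == - 1 * \sum_(1 <= j < n.+1) a j * f ^+ (n - j).
  by rewrite mulN1r -subr_eq0 opprK fn.
have [_ _ M] := order_ge_ideal (n * b).+1; apply: M.
rewrite big_seq_cond; apply: ideal_sum; first exact: order_ge_ideal.
move=> j; rewrite mem_index_iota andbT ltnS => j1n.
have aj : order_ge (j * c) (a j) by apply: (order_ge_pow Jc); apply: aJ.
apply: (@order_ge_le _ (j * c + (n - j) * b)); last first.
  by apply: order_geM => //; apply: order_geX.
have [j1 jn] := andP j1n; rewrite mulnBl; nia.
Qed.

End WeightOrder.

(** * Valuations, symbolic powers and rational powers *)

Section Valuations.
Context {R : realType} {K : fieldType} {d : nat}.
Notation A := {mpoly K[d]}.
Variables (v : A -> \bar R) (u : 'I_d -> nat).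
Hypotheses (vP : is_valuation v) (vu : forall j, v 'X_j = (u j)%:R%:E).
Implicit Types (f g : A) (m : 'X_{1..d}).

Lemma valuation_ge0 f : (0 <= v f)%E.
Proof.
case: vP => v0 fin _ _; have [->|/fin[]//] := eqVneq f 0.
by rewrite v0 leey.
Qed.

Lemma valuation1 : v 1 = 0%E.
Proof.
case: vP => _ fin vM _; have [+ _] := fin 1 (oner_neq0 _).
have := vM 1 1; rewrite mulr1; case: (v 1) => [x| |] //= [xx] _.
by congr EFin; lra.
Qed.

Lemma valuation_exp f n : v (f ^+ n) = (n%:R%:E * v f)%E.
Proof.
case: vP => v0 fin vM _.
elim: n => [|n IH]; first by rewrite expr0 valuation1 mul0e.
by rewrite exprS vM IH -natr1 addrC EFinD ge0_muleDl ?lee_fin // mul1e.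
Qed.

Lemma valuation_mpolyX m : v 'X_[m] = (weight u m)%:R%:E.
Proof.
case: (vP) => _ _ vM _; rewrite mpolyXE_id /weight natr_sum -sumEFin.
rewrite (big_morph v vM valuation1); apply: eq_bigr => j _.
by rewrite valuation_exp vu -EFinM -natrM mulnC.
Qed.

(** The ultrametric inequality bounds [v f] below by the least value of the terms of [f];
    cancellation may make [v f] larger when [v] is not monomial. *)
Lemma order_ge_valuation k f : order_ge u k f -> (k%:R%:E <= v f)%E.
Proof.
case: (vP) => v0 _ vM vD kf; rewrite [f]mpolyE big_seq.
apply: (big_ind (fun g => (k%:R%:E <= v g)%E)) => [|g h kg kh|m /kf km].
- by rewrite v0 leey.
- by apply: le_trans (vD g h); rewrite le_min kg.
rewrite -mul_mpolyC vM valuation_mpolyX.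
by apply: (@le_trans _ _ (weight u m)%:R%:E);
  rewrite ?lee_fin ?ler_nat ?leeDr ?valuation_ge0.
Qed.

Lemma monomial_valuation_order_ge k f : is_monomial_valuation v ->
  (k%:R%:E <= v f)%E <-> order_ge u k f.
Proof.
move=> [_ vinf]; split=> [kv m mf|]; last exact: order_ge_valuation.
suff : (k%:R%:E <= v 'X_[m])%E by rewrite valuation_mpolyX lee_fin ler_nat.
by apply: (le_trans kv); rewrite vinf; apply: ereal_inf_lbound; exists m.
Qed.

End Valuations.

Lemma monomial_span_heavyE (K : fieldType) d (I : finType)
    (w : I -> 'I_d -> nat) n :
  monomial_span (heavy w n) =
  [set f : {mpoly K[d]} | forall i, order_ge (w i) n f].
Proof.
by apply/seteqP; split=> f fw; [move=> i m mf|move=> m mf i]; apply: fw.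
Qed.

Lemma valuation_idealE (R : realType) (K : fieldType) (d r : nat)
    (nu : 'I_r -> {mpoly K[d]} -> \bar R) (w : 'I_r -> 'I_d -> nat) n :
  (forall i, is_monomial_valuation (nu i)) ->
  (forall i j, nu i 'X_j = (w i j)%:R%:E) ->
  valuation_ideal nu n = monomial_span (heavy w n).
Proof.
move=> numon nuw; rewrite monomial_span_heavyE; apply/seteqP; split=> f nf i.
  by apply/(monomial_valuation_order_ge (numon i).1 (nuw i)).
by apply/(monomial_valuation_order_ge (numon i).1 (nuw i)).
Qed.

(** * Symbolic powers of squarefree monomial ideals *)

Section SymbolicPowers.
Context {K : fieldType} {d : nat}.
Notation A := {mpoly K[d]}.
Variable G : set 'X_{1..d}.
Hypothesis Gsqfree : forall m, G m -> forall j : 'I_d, (m j <= 1)%N.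

Let I : set A := ideal_gen [set 'X_[m] | m in G].

Definition vertex_cover (C : {set 'I_d}) : bool :=
  `[< forall m, G m -> exists2 j, j \in C & (0 < m j)%N >].

(** With this weight, [order_ge (indicator C) k] is the k-th power of the prime generated by the
    variables in [C]. *)
Definition indicator (C : {set 'I_d}) (j : 'I_d) : nat := (j \in C).

Lemma order_ge_cover C : vertex_cover C -> I `<=` order_ge (indicator C) 1.
Proof.
move=> /asboolP CG; apply: smallest_sub; first exact: order_ge_ideal.
move=> _ [m /CG[j jC mj] <-]; apply/order_geXP.
by rewrite /weight (bigD1 j) //= /indicator jC mul1n addn_gt0 mj.
Qed.

Lemma order_ge_indicatorX C j :
  order_ge (indicator C) 1 ('X_j : A) <-> j \in C.
Proof. by rewrite order_geXP weightU /indicator lt0b. Qed.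

Lemma weight_indicator_gt0 C m : (0 < weight (indicator C) m)%N ->
  exists2 j, j \in C & (0 < m j)%N.
Proof.
rewrite lt0n sum_nat_eq0 negb_forall => /existsP[j].
by rewrite muln_eq0 negb_or eqb0 negbK -lt0n => /andP[]; exists j.
Qed.

Lemma order_ge_indicator_prime C :
  is_prime_ideal (@order_ge K d (indicator C) 1).
Proof.
split; [exact: order_ge_ideal| |exact: (@order_ge_prime _ _ _ 0 0)].
apply/eqP => /seteqP[_ /(_ 1 Logic.I)] /(_ 0%MM).
by rewrite msupp1 mem_head weight0 => /(_ isT).
Qed.

Lemma order_ge_indicator_sub (C : {set 'I_d}) (P : set A) : is_ideal P ->
  (forall j, j \in C -> P 'X_j) -> order_ge (indicator C) 1 `<=` P.
Proof.
move=> iP CP f f1; apply: ideal_of_terms => // m /f1.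
move=> /weight_indicator_gt0[j jC mj].
have /submK <- : (U_(j) <= m)%MM by rewrite lep1mP -lt0n.
by rewrite mpolyXD; case: iP => _ _ PM; apply/PM/CP.
Qed.

(** By minimality [C :\ j] misses the support of some generator, which therefore meets [C] in [j]
    alone. *)
Lemma minimal_cover_private (C : {set 'I_d}) j :
  minset vertex_cover C -> j \in C ->
  exists g, [/\ G g, (0 < g j)%N & forall k, k \in C -> (0 < g k)%N -> k = j].
Proof.
move=> Cmin jC; have /minsetP[/asboolP Ccov CminP] := Cmin.
apply: contrapT => nG; suff CjC : vertex_cover (C :\ j).
  by have := CminP _ CjC (subD1set _ _) => CE; move: jC; rewrite -CE setD11.
apply/asboolP => g Gg; have [k kC gk] := Ccov g Gg.
apply: contrapT => nk; apply: nG; exists g; split=> //.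
  have [<-//|kj] := eqVneq k j; case: nk; exists k => //; by rewrite !inE kj.
move=> h hC gh; apply/eqP; apply: contraT => hj; case: nk; exists h => //.
by rewrite !inE hj.
Qed.

(** A prime [Q] between [I] and the prime of [C] contains, for each [j] in [C], a variable of a
    generator private to [j]; that variable lies in [C], so it is x_j. *)
Lemma minimal_cover_minimal_prime C : minset vertex_cover C ->
  is_minimal_prime I (order_ge (indicator C) 1).
Proof.
move=> Cmin; have /minsetP[Ccov _] := Cmin; split.
- exact: order_ge_indicator_prime.
- exact: order_ge_cover.
move=> Q Qprime IQ QP; apply/seteqP; split=> //.
apply: order_ge_indicator_sub => [|j jC]; first by case: Qprime.
have [g [Gg gj gP]] := minimal_cover_private Cmin jC.
have [|k gk Qk] := prime_ideal_mpolyX (m := g) Qprime.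
  by apply: IQ; apply: sub_gen_smallest; exists g.
by rewrite -(gP k) //; apply/order_ge_indicatorX; apply: QP.
Qed.

(** The variables in [P] form a cover; a minimal cover inside it gives a prime between [I] and
    [P]. *)
Lemma minimal_prime_minimal_cover P : is_minimal_prime I P ->
  exists2 C, minset vertex_cover C & P = order_ge (indicator C) 1.
Proof.
move=> [Pprime IP Pmin].
have covP : vertex_cover [set j : 'I_d | `[< P 'X_j >]]%SET.
  apply/asboolP => m Gm; have [|j mj Pj] := prime_ideal_mpolyX (m := m) Pprime.
    by apply: IP; apply: sub_gen_smallest; exists m.
  by exists j => //; rewrite inE; apply/asboolP.
have [C Cmin CP] := minset_exists covP; exists C => //.
have /minsetP[Ccov _] := Cmin.
apply/esym/Pmin; [exact: order_ge_indicator_prime|exact: order_ge_cover|].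
apply: order_ge_indicator_sub => [|j /(fintype.subsetP CP)];
  first by case: Pprime.
by rewrite inE => /asboolP.
Qed.

(** At the prime of [C] the variables off [C] are units and a private generator becomes a unit times
    x_j. Each step of the induction spends one x_j and one copy of the variables off [C]. *)
Lemma minimal_cover_mpolyX C n m : minset vertex_cover C ->
  (n <= weight (indicator C) m)%N -> ideal_pow I n 'X_[mset n (~: C) + m].
Proof.
move=> Cmin; elim: n m => [//|n IH] m nm.
have [j jC mj] := weight_indicator_gt0 (leq_ltn_trans (leq0n n) nm).
have Um : (U_(j) <= m)%MM by rewrite lep1mP -lt0n.
have -> : (mset n.+1 (~: C) + m =
    (mset 1 (~: C) + U_(j)) + (mset n (~: C) + (m - U_(j))))%MM.
  rewrite -{1}(submK Um); apply/mnmP=> k; rewrite !mnmDE !mnmE; lia.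
rewrite mpolyXD; apply: ideal_powM; last first.
  apply: IH; move: nm; rewrite -{1}(submK Um) weightD weightU /indicator jC.
  by rewrite addn1 ltnS.
have [g [Gg gj gP]] := minimal_cover_private Cmin jC.
(* Squarefreeness: one copy of each variable off [C], together with x_j, is enough. *)
have /submK <- : (g <= mset 1 (~: C) + U_(j))%MM.
  apply/mnm_lepP => k; rewrite mnmDE !mnmE inE mul1n.
  have [kC|kC] := boolP (k \in C); last by apply: leq_trans (Gsqfree Gg k) _;
    rewrite leq_addr.
  have [gk|gk] := posnP (g k); first by rewrite gk.
  by rewrite (gP k) // eqxx; apply: Gsqfree.
have [_ _ IM] := ideal_gen_is_ideal (K := K) [set 'X_[m] | m in G].
by rewrite mpolyXD; apply: IM; apply: sub_gen_smallest; exists g.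
Qed.

Definition minimal_cover := {C : {set 'I_d} | minset vertex_cover C}.

Lemma symbolic_powerE n :
  symbolic_power I n =
  monomial_span (heavy (fun C : minimal_cover => indicator (val C)) n).
Proof.
rewrite monomial_span_heavyE; apply/seteqP; split=> f.
  move=> sf [C Cmin] /=; case: n sf => [//|n] sf.
  (* [s] has order 0, so all of the order of [s * f] comes from [f]. *)
  have [s [ns sfn]] := sf _ (minimal_cover_minimal_prime Cmin).
  have /minsetP[Ccov _] := Cmin.
  have := order_ge_pow (order_ge_cover Ccov) sfn; rewrite muln1.
  by case/(@order_ge_prime _ _ _ 0).
move=> nf _ /minimal_prime_minimal_cover[C Cmin ->].
(* One multiplier for all terms of [f]: the n-th power of the product of the variables off [C]. *)
exists 'X_[mset n (~: C)]; split.
  apply/order_geXP; rewrite /weight big1 // => j _.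
  by rewrite /indicator mnmE inE; case: (j \in C); rewrite ?muln0.
have iIn := ideal_pow_is_ideal I n.
rewrite [f]mpolyE mulr_sumr big_seq; apply: ideal_sum => // m mf.
rewrite -scalerAr -mul_mpolyC -mpolyXD; case: iIn => _ _; apply.
by apply: minimal_cover_mpolyX => //; have := nf (exist _ C Cmin); apply.
Qed.

End SymbolicPowers.

(** * Rational powers of monomial ideals *)

Section RationalPowers.
Context {R : realType} {K : fieldType} {d r : nat}.
Notation A := {mpoly K[d]}.
Variables (J : set A) (v : 'I_r -> A -> \bar R) (c : 'I_r -> nat).
Hypotheses (Jmon : is_monomial_ideal J) (vRees : are_Rees_valuations J v).
Hypothesis vc : forall i, val_of_ideal (v i) J = (c i)%:R%:E.

(** Values are integers or infinite, so if [c i] were not attained, [c i + 1] would be a larger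
    lower bound. *)
Lemma val_of_ideal_attained i : exists2 f, J f & v i f = (c i)%:R%:E.
Proof.
have [vP _ _] := vRees; have [[v0 _ _ _] vint] := vP i.
apply: contrapT => nf.
suff : ((c i).+1%:R%:E <= (c i)%:R%:E :> \bar R)%E
  by rewrite lee_fin ler_nat ltnn.
rewrite -vc; apply/ereal_infP => _ [f Jf <-].
have cf : ((c i)%:R%:E <= v i f)%E
  by rewrite -vc; apply: ereal_inf_lbound; exists f.
have [f0|/vint[n vn]] := eqVneq f 0; first by rewrite f0 v0 leey.
move: cf; rewrite vn !lee_fin !ler_nat leq_eqVlt => /orP[/eqP cn|//].
by case: nf; exists f; rewrite // cn.
Qed.

Lemma val_of_ideal_pow_le i n :
  (val_of_ideal (v i) (ideal_pow J n) <= (n * c i)%:R%:E)%E.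
Proof.
have [vP _ _] := vRees; have [f Jf vf] := val_of_ideal_attained i.
apply: ereal_inf_lbound; exists (f ^+ n); first exact: ideal_powX.
by rewrite (valuation_exp (vP i).1) vf -EFinM natrM.
Qed.

(* By minimality: a valuation with value 0 on J could be dropped. *)
Lemma Rees_value_gt0 i : (0 < c i)%N.
Proof.
have [vP vJ vmin] := vRees; rewrite lt0n; apply/eqP => ci0.
apply: (vmin (~: [set i])%SET).
  by rewrite properE finset.subsetT; apply/fintype.subsetPn; exists i;
    rewrite !inE // eqxx.
move=> n f; rewrite vJ; split=> nf k; first by move=> _; apply: nf; rewrite inE.
have [-> _|ki _] := eqVneq k i; last by apply: nf; rewrite !inE.
apply: le_trans (val_of_ideal_pow_le i n) _.
by rewrite ci0 muln0; apply: valuation_ge0 (vP i).1 _.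
Qed.

Lemma rational_powerE (e := (\big[lcmn/1]_(i < r) c i)%N) :
  exists w : 'I_r -> 'I_d -> nat,
    forall n, rational_power J n e = monomial_span (heavy w n).
Proof.
have [vP vJ _] := vRees.
have /choice[u0 u0P] (ij : 'I_r * 'I_d) :
    exists k : nat, v ij.1 'X_(ij.2) = k%:R%:E.
  by apply: (vP _).2; rewrite -msupp_eq0 msuppX.
pose u i j := u0 (i, j).
have uP i j : v i 'X_j = (u i j)%:R%:E := u0P (i, j).
have ce i : (c i %| e)%N by apply: (@biglcmn_sup _ i).
have e0 : (0 < e)%N.
  by apply: (big_ind (fun n => 0 < n)%N) => // [a b a0 b0|i _];
    [rewrite lcmn_gt0 a0|exact: Rees_value_gt0].
(* [v i] and the order for [u i] agree on monomials, in particular on the generators of [J]. *)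
have Jc i : J `<=` order_ge (u i) (c i).
  case: Jmon => G GE; rewrite GE; apply: smallest_sub;
    first exact: order_ge_ideal.
  move=> _ [g Gg <-]; apply/order_geXP.
  rewrite -(ler_nat R) -lee_fin -(valuation_mpolyX (vP i).1 (uP i)) -vc.
  by apply: ereal_inf_lbound; exists 'X_[g] => //; rewrite GE;
    apply: sub_gen_smallest; exists g.
exists (fun i j => e %/ c i * u i j)%N => n.
have weightE i m :
    (weight (fun j => e %/ c i * u i j) m * c i = e * weight (u i) m)%N.
  rewrite /weight -[in RHS](divnK (ce i)) mulnAC big_distrr; congr muln.
  by apply: eq_bigr => j _; rewrite /= mulnA.
rewrite monomial_span_heavyE; apply/seteqP; split=> f.
  (* A term of too small weight is impossible: [f ^+ e] has order at least [n * c i], so [f] would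
     have order above the weight of its own term [m]. *)
  move=> nf i m mf; rewrite -(leq_pmul2r (Rees_value_gt0 i)) weightE leqNgt;
    apply/negP => ltn.
  suff /(_ m mf) : order_ge (u i) (weight (u i) m).+1 f by rewrite ltnn.
  apply: (order_geX_prime e0).
  apply: (@order_ge_le _ _ _ _ (n * c i)) => //.
  by apply: order_ge_integral_closure nf; apply: order_ge_pow.
move=> nf; apply/vJ => i _; apply: le_trans (val_of_ideal_pow_le i n) _.
apply: (order_ge_valuation (vP i).1 (uP i)).
have [->|f0] := eqVneq f 0.
  by rewrite expr0n -[e == _]negbK -lt0n e0; apply: monomial_span0.
have [m mf] : exists m, m \in msupp f.
  by move: f0; rewrite -msupp_eq0; case: (msupp f) => // m s _; exists m;
    rewrite mem_head.
have [|a _ [fa nfa]] := @order_exact _ _ (u i) (weight (u i) m).+1 f.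
  by move=> /(_ m mf); rewrite ltnn.
(* Some term of [f] attains the exact order [a]; its scaled weight is at least [n], hence
   [e * a >= n * c i]. *)
have [{}m {}mf ma] : exists2 m, m \in msupp f & weight (u i) m = a.
  apply: contrapT => nm; apply: nfa => m' mf'; rewrite ltn_neqAle fa // andbT.
  by apply/eqP => am; apply: nm; exists m'.
apply: (@order_ge_le _ _ _ _ (e * a)); last exact: order_geX.
by rewrite -ma -weightE leq_pmul2r ?Rees_value_gt0 //; apply: nf.
Qed.

End RationalPowers.

Theorem theorem5p21 (R : realType) (K : fieldType) (d : nat) :
  [/\ forall (r : nat) (nu : 'I_r -> {mpoly K[d]} -> \bar R),
        (forall i, is_monomial_valuation (nu i) /\ is_normalized (nu i)) ->
        a_invariant_growth R (valuation_ideal nu) /\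
        regularity_limit_exists R (valuation_ideal nu),
      forall I : set {mpoly K[d]},
        is_squarefree_monomial_ideal I ->
        a_invariant_growth R (symbolic_power I) /\
        regularity_limit_exists R (symbolic_power I)
    & forall (J : set {mpoly K[d]}) (r : nat)
        (v : 'I_r -> {mpoly K[d]} -> \bar R) (c : 'I_r -> nat),
        is_monomial_ideal J -> J <> [set 0] -> J <> setT ->
        are_Rees_valuations J v ->
        (forall i, val_of_ideal (v i) J = (c i)%:R%:E) ->
        let e := (\big[lcmn/1]_(i < r) c i)%N in
        a_invariant_growth R (fun n => rational_power J n e) /\
        regularity_limit_exists R (fun n => rational_power J n e)].
Proof.
have weighted (I : finType) (w : I -> 'I_d -> nat) (F : nat -> set {mpoly K[d]}) :
    (forall n, F n = monomial_span (heavy w n)) ->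
    a_invariant_growth R F /\ regularity_limit_exists R F.
  by move=> FE; split; [apply: (weighted_growth (w := w))|
    apply: (weighted_regularity_limit (w := w))] => n _; apply: FE.
split=> [r nu nuP|_ [G [Gsqfree ->]]|J r v c Jmon _ _ vRees vc e].
- have /choice[w wP] i : exists wi : 'I_d -> nat, forall j, nu i 'X_j = (wi j)%:R%:E.
    by have /choice[wi wiP] := (nuP i).2; exists wi.
  by apply: (weighted _ w) => n; apply: valuation_idealE => // i; apply: (nuP i).1.
- by apply: weighted => n; apply: symbolic_powerE.
by have [w wE] := rational_powerE Jmon vRees vc; apply: weighted wE.
Qed.
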